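(* Let $p>3$ be a prime, $h\geq 1$, $q=p^h$, and $a,b\in\mathbb{F}_{q^2}^*$. The polynomial $$f_{a,b}(X)=X\bigl(1+aX^{q(q-1)}+bX^{2(q-1)}\bigr)\in\mathbb{F}_{q^2}[X]$$ is a permutation polynomial of $\mathbb{F}_{q^2}$ if and only if either $$\text{(I)}\quad a^qb^q=a\bigl(b^{q+1}-a^{q+1}\bigr)\ \text{ and }\ 1-4(b/a)^{q+1}\in\square_q^*,$$ or $$\text{(II)}\quad a^{q-1}+3b=0\ \text{ and }\ -3\bigl(1-4(b/a)^{q+1}\bigr)\in\square_q^*.$$
   Context: A polynomial $f\in\mathbb{F}_{q^2}[X]$ is a permutation polynomial (PP) of $\mathbb{F}_{q^2}$ if $x\mapsto f(x)$ is a bijection of $\mathbb{F}_{q^2}$. $\square_q^*$ denotes the set of nonzero squares of $\mathbb{F}_q$. *)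

(* Defs.v *)
From HB Require Import structures.
From mathcomp Require Import all_boot all_order all_algebra all_field.
Set Implicit Arguments. Unset Strict Implicit. Unset Printing Implicit Defensive.
Import GRing.Theory.
Local Open Scope ring_scope.

Definition perm_poly (F : finFieldType) (f : {poly F}) : Prop :=
  bijective (fun x : F => f.[x]).

(* c lies in the subfield F_q = {x | x^q = x} of F and is a nonzero square
   of F_q, i.e. c \in \square_q^*. *)
Definition nz_square_q (F : finFieldType) (q : nat) (c : F) : Prop :=
  [/\ c != 0, c ^+ q = c & exists y : F, y ^+ q = y /\ y ^+ 2 = c].

Definition fab (F : finFieldType) (q : nat) (a b : F) : {poly F} :=
  'X * (1 + a *: 'X^(q * (q - 1)) + b *: 'X^(2 * (q - 1))).

(* Main.v *)
Require Import Defs.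
From HB Require Import structures.
From mathcomp Require Import all_boot all_order all_algebra all_solvable all_field.
From mathcomp Require Import ring zify.
Set Implicit Arguments. Unset Strict Implicit.
Import GRing.Theory.
Local Open Scope ring_scope.

(* On the group mu of (q+1)-th roots of unity, f permutes F iff den has no zero
   there and x |-> num x / den x is injective on mu, where
     num x = a^q x^3 + x^2 + b^q   and   den x = b x^3 + x + a.
   Put bez X x = (num X den x - num x den X) / (X - x), a symmetric polynomial of
   degree 2 in each variable, and let disc x be its discriminant in X, a
   self-reciprocal quartic. For x in mu the roots X of bez X x lie in mu iff
   disc x / x^2, an element of F_q, is zero or a nonsquare. So if f permutes F,
   then disc x / x^2 is a nonzero square of F_q for every x in mu, except at
   points that are double zeros of disc. An argument in the style of Stepanov,
   expanding X^4 disc^(q+1) in powers of X^(q+1) - 1, then shows that disc is a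
   constant times the square of a polynomial. The resulting relations between
   the coefficients say that either the resultant of num and den is 0, which
   gives (I) since a single common root would lie in mu, or a^q + 3ab = 0, which
   is (II). In both cases disc is an explicit constant times an explicit square,
   and that constant being a nonzero square of F_q is the second condition;
   this also yields the converse. *)

(** * The Bezoutian of the cubics num and den *)

Section Bezoutian.

Variables (R : fieldType) (a a' b b' : R).

Definition num x := a' * x ^+ 3 + x ^+ 2 + b'.
Definition den x := b * x ^+ 3 + x + a.

Definition bezE := a * a' - b * b'.
Definition bezA x := - b * x ^+ 2 + a' * x + bezE.
Definition bezB x := a' * x ^+ 2 + (bezE + 1) * x + a.
Definition bezC x := bezE * x ^+ 2 + a * x - b'.
Definition bez X x := bezA x * X ^+ 2 + bezB x * X + bezC x.
Definition disc x := bezB x ^+ 2 - 4%:R * bezA x * bezC x.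

Definition disc0 := a ^+ 2 + 4%:R * b' * bezE.
Definition disc1 := 2%:R * a * (1 - bezE) + 4%:R * a' * b'.
Definition disc2 :=
  (bezE + 1) ^+ 2 - 2%:R * a * a' - 4%:R * b * b' - 4%:R * bezE ^+ 2.
Definition disc3 := 2%:R * a' * (1 - bezE) + 4%:R * a * b.
Definition disc4 := a' ^+ 2 + 4%:R * b * bezE.

(* The determinant of the 3x3 matrix of coefficients of bez, that is, up to
   sign, the resultant of num and den. *)
Definition bezdet := (bezE + 1) * b * b' + a' ^+ 2 * b' + a ^+ 2 * b
  + 2%:R * bezE * a * a' - bezE ^+ 3 - bezE ^+ 2.

Lemma bezP X x : num X * den x - num x * den X = (X - x) * bez X x.
Proof. by rewrite /num /den /bez /bezA /bezB /bezC /bezE; ring. Qed.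

Lemma bez_sym X x : bez X x = bez x X.
Proof. by rewrite /bez /bezA /bezB /bezC /bezE; ring. Qed.

Lemma bezA_num_den x : bezA x = a' * den x - b * num x.
Proof. by rewrite /num /den /bezA /bezE; ring. Qed.

Lemma bezB_num_den x : bezB x = den x + x * bezA x.
Proof. by rewrite /den /bezA /bezB /bezE; ring. Qed.

Lemma discE x : disc x =
  disc0 + disc1 * x + disc2 * x ^+ 2 + disc3 * x ^+ 3 + disc4 * x ^+ 4.
Proof.
rewrite /disc /disc0 /disc1 /disc2 /disc3 /disc4 /bezA /bezB /bezC; ring.
Qed.

Lemma bez_sqr X x : (2%:R * bezA x * X + bezB x) ^+ 2 = disc x + 4%:R * bezA x * bez X x.
Proof. by rewrite /disc /bez; ring. Qed.

(* By symmetry of bez, the derivative of disc vanishes wherever x is a double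
   root of bez X x as a polynomial in X. *)
Lemma disc_deriv x :
  disc1 + 2%:R * disc2 * x + 3%:R * disc3 * x ^+ 2 + 4%:R * disc4 * x ^+ 3
  = (2%:R * bezA x * x + bezB x)
      * (2%:R * (2%:R * a' * x + bezE + 1) + 4%:R * (a' - 2%:R * b * x) * x
         - 4%:R * bezA x)
    - 4%:R * (a' - 2%:R * b * x) * bez x x.
Proof.
rewrite /disc1 /disc2 /disc3 /disc4 /bez /bezA /bezB /bezC /bezE; ring.
Qed.

Lemma disc_relation1 :
  disc3 ^+ 2 * disc0 - disc1 ^+ 2 * disc4
  = 16%:R * (a ^+ 2 * b - a' ^+ 2 * b') * bezdet.
Proof.
by rewrite /disc0 /disc1 /disc3 /disc4 /bezdet /bezE; ring.
Qed.

(** With [r = a b / a'], the first relation expresses [b] and [b'] through [a], [a'] and [r]. The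
    second then factors, and its nonconstant factors other than [3 r + 1] divide [bezdet] or are
    powers of [a] and [a']; [r = -1/3] is the equation of (II). *)
Lemma bezdet_neq0_case : 2%:R != 0 :> R -> a != 0 -> a' != 0 -> bezdet != 0 ->
  disc3 ^+ 2 * disc0 = disc1 ^+ 2 * disc4 ->
  8%:R * disc4 ^+ 2 * disc1 = disc3 * (4%:R * disc4 * disc2 - disc3 ^+ 2) ->
  a' + 3%:R * a * b = 0.
Proof.
move=> n2 a0 a'0 det0 rel1 rel2.
have n4 : 4%:R != 0 :> R by rewrite (natrM _ 2 2) mulf_neq0.
have n32 : 32%:R != 0 :> R by rewrite (natrM _ 8 4) (natrM _ 4 2) !mulf_neq0.
have n16 : 16%:R != 0 :> R by rewrite (natrM _ 4 4) !mulf_neq0.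
have : a ^+ 2 * b - a' ^+ 2 * b' = 0.
  move/eqP: rel1; rewrite -subr_eq0 disc_relation1 !mulf_eq0.
  by rewrite (negbTE n16) (negbTE det0) orbF => /eqP.
pose r := a * b / a'.
move/eqP; rewrite subr_eq0 => /eqP hr.
have br : b = r * a' / a by rewrite /r; field; rewrite a0 a'0.
have b'r : b' = r * a / a'.
  have -> : b' = a ^+ 2 * b / a' ^+ 2 by rewrite hr; field.
  by rewrite /r; field.
have eE : bezE = a * a' - r ^+ 2 by rewrite /bezE br b'r; field; rewrite a0 a'0.
have detE : bezdet = (bezE + r) ^+ 2 * (1 - bezE + 2%:R * r).
  by rewrite /bezdet eE br b'r; field; rewrite a0 a'0.
have er : bezE + r != 0.
  by apply: contra_neq det0 => h; rewrite detE h expr0n mul0r.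
have cr : 1 - bezE + 2%:R * r != 0.
  by apply: contra_neq det0 => h; rewrite detE h mulr0.
have : 8%:R * disc4 ^+ 2 * disc1 - disc3 * (4%:R * disc4 * disc2 - disc3 ^+ 2)
  = 32%:R * (a' ^+ 2 / a) * (1 - bezE + 2%:R * r) * (3%:R * r + 1) * (bezE + r) ^+ 3.
  rewrite /disc1 /disc2 /disc3 /disc4 eE br b'r; field; by rewrite a0 a'0.
move/esym/eqP; rewrite rel2 subrr !mulf_eq0 invr_eq0 ?expf_eq0 /=.
rewrite (negbTE n32) (negbTE a0) (negbTE a'0) (negbTE er) (negbTE cr) /= orbF => /eqP hr3.
by rewrite br -[RHS](mulr0 a') -hr3; field.
Qed.

(* t, p and p' are entries of the adjugate of the matrix of bez; when its
   determinant vanishes, the adjugate has rank one and its columns are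
   proportional to (1, r, r^2), where r is a common root of num and den. *)
Lemma bezdet_eq0_root (p := a * b + a' * bezE) (p' := a' * b' + a * bezE)
    (t := b * b' - bezE ^+ 2) :
  bezdet = 0 -> p != 0 -> t ^+ 2 = p * p' /\ den (t / p) = 0.
Proof.
move=> det0 p0.
have tpp : t ^+ 2 = p * p'.
  apply/eqP; rewrite -subr_eq0; apply/eqP; rewrite -[RHS](mulr0 (- bezE)) -det0.
  by rewrite /t /p /p' /bezdet /bezE; ring.
split=> //; have h1 : b * p' = bezE * p + a' * t by rewrite /p /p' /t /bezE; ring.
have h2 : a * p + (bezE + 1) * t + a' * p' = 0.
  by rewrite -det0 /p /p' /t /bezdet /bezE; ring.
have -> : den (t / p) = (b * t * t ^+ 2 + t * p ^+ 2 + a * p ^+ 3) / p ^+ 3.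
  by rewrite /den; field.
rewrite tpp (_ : b * t * (p * p') = t * p * (b * p')); last by ring.
rewrite h1 (_ : _ + _ + _ = p ^+ 2 * (bezE * t + t + a * p) + p * a' * t ^+ 2); last by ring.
rewrite tpp (_ : _ + _ = p ^+ 2 * (a * p + (bezE + 1) * t + a' * p')); last by ring.
by rewrite h2 mulr0 mul0r.
Qed.

(** * The discriminant under the equations of (I) and (II) *)

Lemma bezE_case1 : a != 0 -> a' != 0 ->
  a * b + a' * bezE = 0 -> a' * b' + a * bezE = 0 ->
  b * b' = bezE ^+ 2 /\ a * a' = bezE + bezE ^+ 2.
Proof.
move=> a0 a'0 hI hI'.
have ab : a * b = - (a' * bezE) by apply/eqP; rewrite -addr_eq0 hI.
have ab' : a' * b' = - (a * bezE) by apply/eqP; rewrite -addr_eq0 hI'.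
have e2 : b * b' = bezE ^+ 2.
  apply: (mulfI (mulf_neq0 a0 a'0)).
  transitivity ((a * b) * (a' * b')); first by ring.
  by rewrite ab ab'; ring.
by split=> //; rewrite -e2 /bezE; ring.
Qed.

(** Consequently [bez X x] is [bezB x] times a polynomial in [X] alone, so that its discriminant is
    a constant times [bezB x ^+ 2]. *)
Lemma bezAC_case1 : a != 0 -> a' != 0 ->
  a * b + a' * bezE = 0 -> a' * b' + a * bezE = 0 ->
  forall x, a' * bezA x = - b * bezB x /\ a * bezC x = - b' * bezB x.
Proof.
move=> a0 a'0 hI hI' x; have [_ hn] := bezE_case1 a0 a'0 hI hI'.
have ab : a * b = - (a' * bezE) by apply/eqP; rewrite -addr_eq0 hI.
have ab' : a' * b' = - (a * bezE) by apply/eqP; rewrite -addr_eq0 hI'.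
have h1 : a' ^+ 2 + b * (bezE + 1) = 0.
  apply: (mulfI a0); rewrite mulr0 mulrDr [a * (b * _)]mulrA ab.
  transitivity (a' * (a * a' - (bezE + bezE ^+ 2))); first by ring.
  by rewrite hn subrr mulr0.
have h2 : a ^+ 2 + b' * (bezE + 1) = 0.
  apply: (mulfI a'0); rewrite mulr0 mulrDr [a' * (b' * _)]mulrA ab'.
  transitivity (a * (a * a' - (bezE + bezE ^+ 2))); first by ring.
  by rewrite hn subrr mulr0.
split; apply/eqP; rewrite -subr_eq0.
  rewrite (_ : _ - _ = x * (a' ^+ 2 + b * (bezE + 1)) + (a * b + a' * bezE)).
    by rewrite h1 hI mulr0 addr0.
  by rewrite /bezA /bezB; ring.
rewrite (_ : _ - _ = x * (a ^+ 2 + b' * (bezE + 1)) + x ^+ 2 * (a' * b' + a * bezE)).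
  by rewrite h2 hI' !mulr0 addr0.
by rewrite /bezC /bezB; ring.
Qed.

Lemma disc_case1 : a != 0 -> a' != 0 ->
  a * b + a' * bezE = 0 -> a' * b' + a * bezE = 0 ->
  forall x, disc x = (1 - 4%:R * (b * b' / (a * a'))) * bezB x ^+ 2.
Proof.
move=> a0 a'0 hI hI' x; have [hA hC] := bezAC_case1 a0 a'0 hI hI' x.
have -> : disc x = bezB x ^+ 2 - 4%:R * (a' * bezA x) * (a * bezC x) / (a * a').
  by rewrite /disc; field; rewrite a0 a'0.
by rewrite hA hC; field; rewrite a0 a'0.
Qed.

(** Up to a constant, the square root of [disc] under (II); the division by 3 makes that constant
    exactly the one required to be a square in (II). *)
Definition linII x := (a' * x ^+ 2 + 3%:R * a * a' * x + a) / 3%:R.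

Lemma case2_b : 3%:R != 0 :> R -> a != 0 -> a' != 0 ->
  a' + 3%:R * a * b = 0 -> a + 3%:R * a' * b' = 0 ->
  b = - a' / (3%:R * a) /\ b' = - a / (3%:R * a').
Proof.
move=> n3 a0 a'0 hI hI'; split.
  have -> : a' = - (3%:R * a * b) by apply/eqP; rewrite -addr_eq0 hI.
  by field; rewrite n3 a0.
have {1}-> : a = - (3%:R * a' * b') by apply/eqP; rewrite -addr_eq0 hI'.
by field; rewrite n3 a'0.
Qed.

Lemma disc_case2 : 3%:R != 0 :> R -> a != 0 -> a' != 0 ->
  a' + 3%:R * a * b = 0 -> a + 3%:R * a' * b' = 0 ->
  forall x, disc x = - 3%:R * (1 - 4%:R * (b * b' / (a * a'))) * linII x ^+ 2.
Proof.
move=> n3 a0 a'0 hI hI' x; have [hb hb'] := case2_b n3 a0 a'0 hI hI'.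
rewrite /disc /bezA /bezB /bezC /linII /bezE hb hb'; field.
by rewrite n3 a0 a'0.
Qed.

(** By Vieta, two distinct roots of [linII] have sum [-3 a] and product [a / a'], which determine
    the symmetric [bez]. The value is nonzero unless [9 a a' = 4]. *)
Lemma bez_case2 : 3%:R != 0 :> R -> a != 0 -> a' != 0 ->
  a' + 3%:R * a * b = 0 -> a + 3%:R * a' * b' = 0 ->
  forall X x, X != x -> linII X = 0 -> linII x = 0 ->
  bez X x = a / (9%:R * a') * (9%:R * a * a' - 4%:R) ^+ 2.
Proof.
move=> n3 a0 a'0 hI hI' X x Xx LX Lx; have [hb hb'] := case2_b n3 a0 a'0 hI hI'.
have n9 : 9%:R != 0 :> R by rewrite (natrM _ 3 3) mulf_neq0.
have hs : X + x = - 3%:R * a.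
  apply: (mulfI a'0); apply: (mulfI (_ : X - x != 0)); first by rewrite subr_eq0.
  apply/eqP; rewrite -subr_eq0; apply/eqP.
  transitivity (3%:R * (linII X - linII x)); last by rewrite LX Lx subrr mulr0.
  by rewrite /linII; field.
have hp : X * x = a / a'.
  have -> : X = - 3%:R * a - x by rewrite -hs addrK.
  have -> : (- 3%:R * a - x) * x = a / a' - 3%:R * linII x / a'.
    by rewrite /linII; field; rewrite n3 a'0.
  by rewrite Lx mulr0 mul0r subr0.
have -> : bez X x = - b * (X * x) ^+ 2 + a' * (X * x) * (X + x)
    + bezE * ((X + x) ^+ 2 - X * x) + X * x + a * (X + x) - b'.
  by rewrite /bez /bezA /bezB /bezC; ring.
by rewrite hs hp /bezE hb hb'; field; rewrite ?n9 ?n3 ?a0 ?a'0.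
Qed.

End Bezoutian.

(** * The field F of order q^2 and its unit circle *)

Section QuadraticExtension.

Variables (F : finFieldType) (p h : nat).
Hypotheses (hp : prime p) (hp3 : (3 < p)%N) (hh : (1 <= h)%N).
Hypothesis hF : #|F| = ((p ^ h) ^ 2)%N.
Let q := (p ^ h)%N.

Lemma pchar_F : p \in [pchar F].
Proof. by apply: (@card_finPcharP _ _ (h * 2)) => //; rewrite expnM. Qed.

Lemma pnat_q : [pchar F].-nat q.
Proof. by rewrite (eq_pnat _ (pcharf_eq pchar_F)) pnatX pnat_id. Qed.

Lemma q_ge5 : (4 < q)%N.
Proof.
have p4 : p != 4 by apply: contraL hp => /eqP ->.
have : (p ^ 1 <= q)%N by rewrite leq_exp2l //; lia.
rewrite expn1; lia.
Qed.

Lemma q_odd : odd q.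
Proof. by rewrite oddX; case: (even_prime hp) => [p2|->]; [lia | rewrite orbT]. Qed.

Lemma two_neq0 : 2%:R != 0 :> F.
Proof. by rewrite -(dvdn_pcharf pchar_F) gtnNdvd //; lia. Qed.

Lemma three_neq0 : 3%:R != 0 :> F.
Proof. by rewrite -(dvdn_pcharf pchar_F) gtnNdvd //; lia. Qed.

Lemma four_neq0 : 4%:R != 0 :> F.
Proof. by rewrite (natrM _ 2 2) mulf_neq0 ?two_neq0. Qed.

Lemma frobD (x y : F) : (x + y) ^+ q = x ^+ q + y ^+ q.
Proof. exact/exprDn_pchar/pnat_q. Qed.

Lemma frobN (x : F) : (- x) ^+ q = - x ^+ q.
Proof. by rewrite exprNn -signr_odd q_odd mulN1r. Qed.

Lemma frob_nat n : (n%:R : F) ^+ q = n%:R.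
Proof.
have q0 := q_ge5; elim: n => [|n IH]; first by rewrite expr0n gtn_eqF //; lia.
by rewrite -[n.+1]addn1 natrD frobD IH expr1n.
Qed.

Lemma frobK (x : F) : (x ^+ q) ^+ q = x.
Proof. by rewrite -exprM -[RHS]expf_card hF. Qed.

Definition frobE := (frobD, frobN, exprMn, exprVn, frobK, frob_nat, expr1n).

Lemma unit_circle_frob (x : F) : x ^+ q.+1 = 1 -> x != 0 /\ x ^+ q = x^-1.
Proof.
move=> x1; have x0 : x != 0.
  by apply/eqP => x0; move/eqP: x1; rewrite x0 expr0n eq_sym oner_eq0.
by split=> //; apply: (mulfI x0); rewrite -exprS x1 divff.
Qed.

Lemma prim_root_F : exists z : F, (q ^ 2 - 1).-primitive_root z.
Proof.
have q5 := q_ge5.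
pose rs := enum (predC1 (0 : F)).
have : has (q ^ 2 - 1).-primitive_root rs.
  apply: has_prim_root; first by rewrite subn_gt0 -{1}(expn0 q) ltn_exp2l //; lia.
  - apply/allP => x; rewrite mem_enum => x0; apply/unity_rootP.
    apply: (mulfI x0); rewrite -exprS mulr1 -[RHS]expf_card hF.
    by congr (_ ^+ _); rewrite /q; have := expn_gt0 (p ^ h) 2; lia.
  - by rewrite enum_uniq.
  by rewrite -cardE cardC1 hF subn1.
by case/hasP => z _ hz; exists z.
Qed.

Lemma unit_circle_prim : exists z : F, [/\ z != 0, q.+1.-primitive_root (z ^+ (q - 1))
   & (q ^ 2 - 1).-primitive_root z].
Proof.
have q5 := q_ge5; have [z hz] := prim_root_F; exists z.
have e : (q ^ 2 - 1 = (q - 1) * q.+1)%N by rewrite expnS expn1; nia.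
split=> //.
  apply/eqP => z0; have := prim_expr_order hz.
  rewrite z0 expr0n gtn_eqF ?(prim_order_gt0 hz) // => /eqP.
  by rewrite eq_sym oner_eq0.
have := exp_prim_root hz (q - 1); rewrite e gcdnMr mulKn //; lia.
Qed.

(** Hilbert 90 for the quadratic extension, read off from a generator of the cyclic group of
    units. *)
Lemma unit_circle_norm1 (x : F) : x ^+ q.+1 = 1 -> exists2 y, y != 0 & x = y ^+ (q - 1).
Proof.
have [z [z0 hz _]] := unit_circle_prim => /(prim_rootP hz)[i ->].
by exists (z ^+ i); rewrite ?expf_neq0 // -!exprM mulnC.
Qed.

(** Over [F], X^(q+1) - 1 is a product of distinct linear factors, one for each point of mu. *)
Lemma unit_circle_dvdp (G : {poly F}) :
  (forall x, x ^+ q.+1 = 1 -> root G x) -> 'X^(q.+1) - 1 %| G.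
Proof.
have [z [_ hz _]] := unit_circle_prim => hG.
rewrite -(factor_Xn_sub_1 hz) /index_iota subn0.
rewrite -(big_map (fun i => (z ^+ (q - 1)) ^+ i) xpredT (fun x => 'X - x%:P)).
apply: uniq_roots_dvdp.
  apply/allP => _ /mapP[i _ ->]; apply: hG.
  by rewrite [LHS]exprAC (prim_expr_order hz) expr1n.
rewrite uniq_rootsE map_inj_in_uniq ?iota_uniq // => i j.
rewrite !mem_iota !add0n /= => hi hj /eqP.
by rewrite (eq_prim_root_expr hz) !modn_small // => /eqP.
Qed.

(* c is a power of a generator of F^*, with exponent divisible by q + 1, hence even. *)
Lemma subfield_sqrt (c : F) : c ^+ q = c -> exists r, r ^+ 2 = c.
Proof.
have q5 := q_ge5; have [z [z0 _ hz]] := unit_circle_prim => hc.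
have [->|c0] := eqVneq c 0; first by exists 0; rewrite expr0n.
have e : (q ^ 2 - 1 = (q - 1) * q.+1)%N by rewrite expnS expn1; nia.
have c1 : c ^+ (q - 1) = 1.
  by apply: (mulfI c0); rewrite -exprS subn1 prednK ?mulr1 //; lia.
have [[i _] /= ci] : {i : 'I_(q ^ 2 - 1) | c = z ^+ i}.
  by apply: (prim_rootP hz); rewrite e exprM c1 expr1n.
move/eqP: c1; rewrite ci -exprM -(prim_order_dvd hz) e mulnC dvdn_pmul2r;
  last by rewrite subn_gt0; lia.
move=> di; exists (z ^+ i./2); rewrite -exprM muln2 even_halfK //.
by have := dvdn_trans _ di; move/(_ 2); rewrite !dvdn2 /= negbK q_odd; apply.
Qed.

(** * Self-reciprocal quartics that are squares on the unit circle *)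

(** Padding with zeros lets the same coefficient lemmas serve polynomials of lower degree. *)
Definition quartic (d0 d1 d2 d3 d4 : F) : {poly F} :=
  d0%:P + d1%:P * 'X + d2%:P * 'X^2 + d3%:P * 'X^3 + d4%:P * 'X^4.

Lemma coef_quartic d0 d1 d2 d3 d4 i :
  (quartic d0 d1 d2 d3 d4)`_i = [:: d0; d1; d2; d3; d4]`_i.
Proof.
by rewrite !coefE; case: i => [|[|[|[|[|i]]]]]; rewrite /= ?nth_nil; ring.
Qed.

Lemma size_quartic d0 d1 d2 d3 d4 : (size (quartic d0 d1 d2 d3 d4) <= 5)%N.
Proof. by apply/leq_sizeP => j hj; rewrite coef_quartic nth_default. Qed.

Lemma horner_quartic d0 d1 d2 d3 d4 x : (quartic d0 d1 d2 d3 d4).[x]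
  = d0 + d1 * x + d2 * x ^+ 2 + d3 * x ^+ 3 + d4 * x ^+ 4.
Proof. by rewrite !(hornerD, hornerM, hornerC, hornerXn, hornerX). Qed.

Lemma deriv_quartic d0 d1 d2 d3 d4 : (quartic d0 d1 d2 d3 d4)^`()
  = quartic d1 (2%:R * d2) (3%:R * d3) (4%:R * d4) 0.
Proof.
apply/polyP => i; rewrite coef_deriv !coef_quartic.
by case: i => [|[|[|[|[|i]]]]]; rewrite /= ?nth_nil; ring.
Qed.

(* The two conclusions hold for the coefficients of any constant multiple of a
   square. With U = X^(q+1) - 1, the polynomial X^2 D^((q+1)/2) is D modulo U,
   and its square X^4 D^(q+1) has a U-adic expansion with coefficients of low
   degree since D^q is a polynomial in X^q. Comparing the expansions, the top
   digit H2 of X^2 D^((q+1)/2) satisfies H2^2 = 4 d0 D. *)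
Lemma self_reciprocal_quartic_square d0 d1 d2 d3 d4 (D := quartic d0 d1 d2 d3 d4) :
    d0 = d4 ^+ q -> d1 = d3 ^+ q -> d2 = d2 ^+ q ->
    (forall x, x ^+ q.+1 = 1 ->
       x ^+ 2 * D.[x] ^+ q./2 = 1 \/ D.[x] = 0 /\ D^`().[x] = 0) ->
  d3 ^+ 2 * d0 = d1 ^+ 2 * d4
  /\ 8%:R * d4 ^+ 2 * d1 = d3 * (4%:R * d4 * d2 - d3 ^+ 2).
Proof.
move=> e0 e1 e2 hD; have q5 := q_ge5; have qo := q_odd.
have eq2 : q = (q./2).*2.+1 by rewrite -[LHS]odd_double_half qo.
pose U : {poly F} := 'X^(q.+1) - 1.
have sU : size U = q.+2 by rewrite size_XnsubC.
have U0 : U != 0 by rewrite -size_poly_eq0 sU.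
have polyq (A B : {poly F}) : (A + B) ^+ q = A ^+ q + B ^+ q.
  apply: exprDn_pchar; rewrite (eq_pnat _ (@pcharf_eq {poly F} p _)) ?pnatX ?pnat_id //.
  by rewrite inE hp /= -polyC_natr polyC_eq0 -(dvdn_pcharf pchar_F) dvdnn.
have UE : U = 'X * 'X^q - 1 by rewrite /U exprS.
(* Since X^(q+1) = 1 + U, X^4 D^q is the sum of the d_j X^j (1 + U)^(4-j); [P1], [P2], [P3] and [d0]
   are its coefficients of U, U^2, U^3 and U^4. *)
pose P1 := quartic (4%:R * d0) (3%:R * d1) (2%:R * d2) d3 0.
pose P2 := quartic (6%:R * d0) (3%:R * d1) d2 0 0.
pose P3 := quartic (4%:R * d0) d1 0 0 0.
pose Q := P1 + U * P2 + U ^+ 2 * P3 + U ^+ 3 * d0%:P.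
have f0 : d0 ^+ q = d4 by rewrite e0 frobK.
have f1 : d1 ^+ q = d3 by rewrite e1 frobK.
have hQ : 'X^4 * D ^+ q = D + U * Q.
  have mon c i : (c%:P * 'X^i) ^+ q = (c ^+ q)%:P * 'X^q ^+ i :> {poly F}.
    by rewrite exprMn -polyC_exp -!exprM mulnC.
  have := mon d3 3; have := mon d4 4; have := mon d2 2; have := mon d1 1%N.
  rewrite expr1 {1}/D /quartic !polyq -polyC_exp => -> -> -> ->.
  rewrite f0 f1 -e1 -e2 -e0 /Q UE /D /P1 /P2 /P3 /quartic.
  rewrite !polyCM !polyC_natr polyC0.
  ring.
(* As [q] is odd, the exponent is (q+1)/2. *)
pose W := D ^+ (q./2).+1.
have hW : ('X^2 * W) ^+ 2 = D * (D + U * Q).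
  rewrite -hQ [RHS]mulrCA -exprS.
  have -> : q.+1 = ((q./2).+1 * 2)%N by lia.
  by rewrite exprM exprMn -[('X^2) ^+ 2]exprM.
have [H1 hH1] : exists H1, 'X^2 * W = D + U * H1.
  have /dvdpP[H1 hH] : U %| 'X^2 * W - D.
    apply: unit_circle_dvdp => x /hD hx; rewrite /root hornerD hornerN hornerM hornerXn horner_exp.
    rewrite subr_eq0 [D.[x] ^+ _]exprS mulrCA.
    by case: hx => [->|[-> _]]; rewrite ?mulr1 // mul0r.
  by exists H1; rewrite [U * _]mulrC -hH addrC subrK.
have hPH : D * (Q - 2%:R * H1) = U * H1 ^+ 2.
  apply: (mulfI U0).
  have -> : U * (U * H1 ^+ 2) = D * (D + U * Q) - D ^+ 2 - 2%:R * D * U * H1.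
    by rewrite -hW hH1; ring.
  by ring.
(* Where D is nonzero on mu, [hPH] gives 2 H1 = Q = P1. At a double zero of D, P1 = 4 D - X D'
   vanishes, and differentiating [hH1] shows that H1 vanishes too, because U' = X^q. *)
have [H2 hH2] : exists H2, 2%:R * H1 = P1 + U * H2.
  have /dvdpP[H2 hH] : U %| 2%:R * H1 - P1.
    apply: unit_circle_dvdp => x hx.
    have Ux : U.[x] = 0 by rewrite /U hornerD hornerN hornerXn hornerC hx subrr.
    have Qx : Q.[x] = P1.[x].
      by rewrite /Q !hornerD !hornerM ?horner_exp Ux ?expr0n ?mul0r ?addr0.
    have [hx1|[Dx D'x]] := hD x hx.
      have Dx0 : D.[x] != 0.
        apply: contra_eq_neq hx1 => ->; rewrite expr0n gtn_eqF ?mulr0 1?eq_sym ?oner_eq0 //; lia.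
      have := congr1 (fun G => G.[x]) hPH; rewrite /= !hornerM Ux mul0r => /eqP.
      rewrite mulf_eq0 (negbTE Dx0) /= hornerD hornerN Qx subr_eq0 eq_sym => hx2.
      by rewrite /root hornerD hornerN subr_eq0.
    have P1x : P1.[x] = 0.
      have : P1.[x] = 4%:R * D.[x] - x * D^`().[x].
        by rewrite /P1 /D /quartic !(derivE, hornerE) /=; ring.
      by move->; rewrite Dx D'x; ring.
    have : ('X^2 * W)^`().[x] = (D + U * H1)^`().[x] by rewrite hH1.
    have Wx : W.[x] = 0 by rewrite /W horner_exp Dx expr0n.
    have W'x : W^`().[x] = 0.
      by rewrite /W deriv_exp hornerMn hornerM D'x mul0r mul0rn.
    have U'x : U^`().[x] = x ^+ q.
      rewrite /U derivB derivC subr0 derivXn hornerMn hornerXn mulrSr -mulr_natr.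
      have /eqP-> : (q%:R == 0 :> F) by rewrite -(dvdn_pcharf pchar_F) dvdn_exp.
      by rewrite mulr0 add0r.
    rewrite derivM hornerD !hornerM Wx W'x !mulr0 addr0 derivD derivM.
    rewrite hornerD D'x add0r hornerD !hornerM Ux mul0r addr0 U'x => /eqP.
    rewrite eq_sym mulf_eq0 expf_eq0 (negbTE (proj1 (unit_circle_frob hx))) andbF /= => /eqP H1x.
    by rewrite /root hornerD hornerN hornerM H1x P1x mulr0 subr0.
  by exists H2; rewrite [U * _]mulrC -hH addrC subrK.
(* These collect the powers of U in (2 H1)^2 - 4 H1^2 = 0, where 2 H1 = P1 + U H2 and H1^2 = D (P2 -
   H2 + U P3 + U^2 d0). *)
pose A4 := H2 ^+ 2 - 4%:R * d0%:P * D.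
pose A3 := 2%:R * P1 * H2 - 4%:R * D * P3.
pose A2 := 4%:R * D * H2 + P1 ^+ 2 - 4%:R * D * P2.
have hA : A2 + U * A3 + U ^+ 2 * A4 = 0.
  have h4 : D * (P2 - H2 + U * P3 + U ^+ 2 * d0%:P) = H1 ^+ 2.
    apply: (mulfI U0); rewrite -hPH hH2 /Q; ring.
  have -> : A2 + U * A3 + U ^+ 2 * A4 = (P1 + U * H2) ^+ 2
      - 4%:R * (D * (P2 - H2 + U * P3 + U ^+ 2 * d0%:P)).
    by rewrite /A2 /A3 /A4; ring.
  by rewrite h4 -hH2; ring.
have szD n (A B : {poly F}) : (size A <= n -> size B <= n -> size (A + B)%R <= n)%N.
  by move=> hA' hB; apply: leq_trans (size_polyD _ _) _; rewrite geq_max hA' hB.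
have szB n (A B : {poly F}) : (size A <= n -> size B <= n -> size (A - B)%R <= n)%N.
  by move=> hA' hB; apply: szD; rewrite ?size_polyN.
have szM m n (A B : {poly F}) :
    (size A <= m.+1 -> size B <= n.+1 -> size (A * B)%R <= (m + n).+1)%N.
  move=> hA' hB; apply: leq_trans (size_polyMleq _ _) _; lia.
have szc m (c : F) : (size c%:P <= m.+1)%N by apply: leq_trans (size_polyC_leq1 _) _.
have szn m n : (size (n%:R : {poly F}) <= m.+1)%N by rewrite -polyC_natr szc.
have sUM G : G != 0 -> size (U * G) = (size G + q.+1)%N.
  by move=> G0; rewrite size_mul // sU addnC addnS.
have sD : (size D <= 5)%N by exact: size_quartic.
have sP1 : (size P1 <= 4)%N.
  by apply/leq_sizeP => -[|[|[|[|[|j]]]]] // _; rewrite coef_quartic //= nth_nil.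
have sP2 : (size P2 <= 3)%N.
  by apply/leq_sizeP => -[|[|[|[|[|j]]]]] // _; rewrite coef_quartic //= nth_nil.
have sP3 : (size P3 <= 2)%N.
  by apply/leq_sizeP => -[|[|[|[|[|j]]]]] // _; rewrite coef_quartic //= nth_nil.
(* X^2 W has degree at most 2q + 4, and each division by U lowers the bound by q + 1: to q + 3 for
   [H1], then to 2 for [H2]. *)
have sH1 : (size H1 <= q + 4)%N.
  have [->|H10] := eqVneq H1 0; first by rewrite size_poly0.
  have : (size (U * H1)%R <= (2 + 4 * (q./2).+1).+1)%N.
    have -> : U * H1 = 'X^2 * W - D by rewrite hH1; ring.
    apply: szB; last by apply: leq_trans sD _; lia.
    apply: szM; first by rewrite size_polyXn.
    apply: leq_trans (size_poly_exp_leq _ _) _.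
    by rewrite ltnS leq_mul2r; lia.
  by rewrite sUM //; lia.
have sH2 : (size H2 <= 3)%N.
  have [->|H20] := eqVneq H2 0; first by rewrite size_poly0.
  have : (size (U * H2)%R <= (q + 3).+1)%N.
    have -> : U * H2 = 2%:R * H1 - P1 by rewrite hH2; ring.
    apply: szB; last by apply: leq_trans sP1 _; lia.
    by apply: (szM 0 (q + 3)); rewrite ?szn // -addnS.
  by rewrite sUM //; lia.
have sA3 : (size A3 <= 6)%N.
  apply: szB; first by apply: (szM 3 2) => //; apply: (szM 0 3).
  by apply: (szM 4 1) => //; apply: (szM 0 4).
have sA2 : (size A2 <= 7)%N.
  apply: szB; last by apply: (szM 4 2) => //; apply: (szM 0 4).
  apply: szD; first by apply: (szM 4 2) => //; apply: (szM 0 4).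
  by apply: (szM 3 3).
(* Otherwise U^2 A4 has degree at least 2q + 2, while A2 + U A3 has degree at most q + 6; this is
   where q > 4 matters. *)
have A40 : A4 = 0.
  apply/eqP; apply: contraT => A40; exfalso.
  have : (size (U * (U * A4))%R <= q + 7)%N.
    have -> : U * (U * A4) = - A2 - U * A3.
      by apply/eqP; rewrite -subr_eq0; apply/eqP; rewrite -hA; ring.
    apply: szB; first by rewrite size_polyN; apply: leq_trans sA2 _; lia.
    have [->|A30] := eqVneq A3 0; first by rewrite mulr0 size_poly0.
    by rewrite sUM //; lia.
  rewrite !sUM ?mulf_neq0 //; have : (0 < size A4)%N by rewrite size_poly_gt0.
  lia.
have [d00|d00] := eqVneq d0 0.
  have d40 : d4 = 0 by rewrite -f0 d00 expr0n gtn_eqF //; lia.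
  have H20 : H2 = 0.
    move/eqP: A40; rewrite /A4 d00 polyC0 mulr0 mul0r subr0 expf_eq0.
    by move=> /andP[_ /eqP].
  suff d10 : d1 = 0.
    have -> : d3 = 0 by rewrite -f1 d10 expr0n gtn_eqF //; lia.
    by rewrite d10 d00 d40; split; ring.
  (* This coefficient is that of X^4 in [A3], namely -4 d1 d3, since [A2] and [A3] have degree below
     q + 5. *)
  have : (A2 + U * A3)`_(q + 5) = 0.
    by move: hA; rewrite A40 mulr0 addr0 => ->; rewrite coef0.
  rewrite coefD nth_default; last by apply: leq_trans sA2 _; lia.
  have -> : A3 = quartic 0 0 (- 4%:R * d1 ^+ 2) (- 4%:R * d1 * d2) (- 4%:R * d1 * d3).
    rewrite /A3 /D /P3 /quartic H20 d00 d40 mulr0 !polyC0 !polyCM !polyC_natr !polyCN.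
    by rewrite ?polyC_natr; ring.
  rewrite /U mulrBl mul1r coefB coefXnM !coef_quartic add0r.
  rewrite [X in _ - X]nth_default /=; last by lia.
  have -> : (q + 5 < q.+1)%N = false by lia.
  rewrite (_ : (q + 5 - q.+1)%N = 4); last by lia.
  rewrite subr0 /= => /eqP; rewrite !mulf_eq0 oppr_eq0 (negbTE four_neq0) /=.
  case/orP=> [/eqP //|/eqP d30].
  by rewrite e1 d30 expr0n gtn_eqF //; lia.
pose k i := H2`_i.
have hk : 4%:R * d0%:P * D = quartic (k 0%N ^+ 2) (2%:R * k 0%N * k 1%N)
    (k 1%N ^+ 2 + 2%:R * k 0%N * k 2) (2%:R * k 1%N * k 2) (k 2 ^+ 2).
  have hH2k : H2 = quartic (k 0%N) (k 1%N) (k 2) 0 0.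
    apply/polyP => i; rewrite coef_quartic.
    case: i => [|[|[|i]]] //; rewrite nth_default; last by apply: leq_trans sH2 _.
    by case: i => [|[|[|i]]].
  have -> : 4%:R * d0%:P * D = H2 ^+ 2 by apply/eqP; rewrite eq_sym -subr_eq0 -/A4 A40.
  rewrite hH2k /quartic !polyC0 !polyCD !polyCM !polyC_natr; ring.
have hki i : 4%:R * d0 * [:: d0; d1; d2; d3; d4]`_i
    = [:: k 0%N ^+ 2; 2%:R * k 0%N * k 1%N; k 1%N ^+ 2 + 2%:R * k 0%N * k 2;
          2%:R * k 1%N * k 2; k 2 ^+ 2]`_i.
  by rewrite -[RHS]coef_quartic -hk -polyC_natr -polyCM coefCM coef_quartic.
have c0 : 4%:R * d0 != 0.
  by rewrite mulf_neq0 ?four_neq0.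
have := hki 0%N; have := hki 1%N; have := hki 2; have := hki 3; have := hki 4.
rewrite /=; set c := 4%:R * d0 => k4 k3 k2 k1 k0.
split; apply: (mulfI (expf_neq0 3 c0)).
  have -> : c ^+ 3 * (d3 ^+ 2 * d0) = (c * d3) ^+ 2 * (c * d0) by ring.
  have -> : c ^+ 3 * (d1 ^+ 2 * d4) = (c * d1) ^+ 2 * (c * d4) by ring.
  by rewrite k4 k3 k1 k0; ring.
have -> : c ^+ 3 * (8%:R * d4 ^+ 2 * d1) = 8%:R * (c * d4) ^+ 2 * (c * d1) by ring.
have -> : c ^+ 3 * (d3 * (4%:R * d4 * d2 - d3 ^+ 2))
   = (c * d3) * (4%:R * (c * d4) * (c * d2) - (c * d3) ^+ 2) by ring.
by rewrite k4 k3 k2 k1; ring.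
Qed.

(** * Reduction to the unit circle *)

Variables (a b : F).
Hypotheses (ha : a != 0) (hb : b != 0).
Let a' := a ^+ q.
Let b' := b ^+ q.

Local Notation bzE := (bezE a a' b b').
Local Notation bzA := (bezA a a' b b').
Local Notation bzB := (bezB a a' b b').
Local Notation bzC := (bezC a a' b b').
Local Notation bz := (bez a a' b b').
Local Notation dsc := (disc a a' b b').
Local Notation nm := (num a' b').
Local Notation dn := (den a b).

Lemma a'_neq0 : a' != 0. Proof. exact: expf_neq0. Qed.

Lemma frob_bezE : bzE ^+ q = bzE.
Proof. by rewrite /bezE /a' /b' !frobE; ring. Qed.

(** On mu, x^q = 1/x, so the q-th power conjugates coefficients and reverses their order. Up to
    powers of [x], this exchanges [den] with [num] and [bezA] with [bezC], and fixes [bezB]. *)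
Lemma frob_den x : x ^+ q.+1 = 1 -> dn x ^+ q = nm x / x ^+ 3.
Proof.
move=> hx; have [x0 xq] := unit_circle_frob hx.
by rewrite /den /num !frobE ?exprAC !xq -/a' -/b'; field.
Qed.

Lemma frob_bezA x : x ^+ q.+1 = 1 -> bzA x ^+ q = bzC x / x ^+ 2.
Proof.
move=> hx; have [x0 xq] := unit_circle_frob hx.
by rewrite /bezA /bezC /bezE !frobE ?exprAC !xq /a' /b' ?frobE; field.
Qed.

Lemma frob_bezB x : x ^+ q.+1 = 1 -> bzB x ^+ q = bzB x / x ^+ 2.
Proof.
move=> hx; have [x0 xq] := unit_circle_frob hx.
by rewrite /bezB /bezE !frobE ?exprAC !xq /a' /b' ?frobE; field.
Qed.

Lemma frob_bezC x : x ^+ q.+1 = 1 -> bzC x ^+ q = bzA x / x ^+ 2.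
Proof.
move=> hx; have [x0 xq] := unit_circle_frob hx.
by rewrite /bezA /bezC /bezE !frobE ?exprAC !xq /a' /b' ?frobE; field.
Qed.

Lemma frob_disc x : x ^+ q.+1 = 1 -> (dsc x / x ^+ 2) ^+ q = dsc x / x ^+ 2.
Proof.
move=> hx; have [x0 xq] := unit_circle_frob hx.
move: (frob_bezA hx) (frob_bezB hx) (frob_bezC hx); rewrite /disc.
move: (bzA x) (bzB x) (bzC x) => A B C hA hB hC.
by rewrite !frobE ?exprAC hA hB hC xq; field; rewrite x0 oner_neq0.
Qed.

(** For x = y^(q-1) one has x^q = 1/x, so f(y) = y (1 + a/x + b x^2). *)
Lemma fab_horner y : y != 0 ->
  (fab q a b).[y] = y / y ^+ (q - 1) * dn (y ^+ (q - 1)) /\ (y ^+ (q - 1)) ^+ q.+1 = 1.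
Proof.
have q5 := q_ge5; move=> y0; set x := y ^+ (q - 1).
have hx : x ^+ q.+1 = 1.
  apply: (mulfI y0); rewrite mulr1 /x -exprM -exprS -[RHS]expf_card hF -/q.
  by congr (_ ^+ _); rewrite expnS expn1; nia.
have [x0 xq] := unit_circle_frob hx; split=> //.
rewrite /fab !hornerE (mulnC q) (mulnC 2) !exprM -/x xq /den.
by field.
Qed.

Lemma fab_horner0 : (fab q a b).[0] = 0.
Proof. by rewrite /fab hornerM hornerX mul0r. Qed.

Lemma fab_quotient y : y != 0 -> dn (y ^+ (q - 1)) != 0 ->
  let u := (fab q a b).[y] in
  u != 0 /\ u ^+ q = u * (nm (y ^+ (q - 1)) / dn (y ^+ (q - 1))).
Proof.
have q5 := q_ge5; move=> y0 d0 /=; have [-> hx] := fab_horner y0.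
have yq : y ^+ q = y * y ^+ (q - 1) by rewrite -exprS subn1 prednK //; lia.
set x := y ^+ (q - 1) in d0 hx yq *.
have [x0 xq] := unit_circle_frob hx; split; first by rewrite !mulf_neq0 ?invr_neq0.
by rewrite !exprMn exprVn xq yq frob_den //; field; rewrite d0 x0 oner_neq0.
Qed.

(** The fibres of y -> y^(q-1) on nonzero elements are cosets of F_q^*, on which f is homogeneous of
    degree 1. Hence f is injective iff it has no nonzero root and the induced map num/den on mu is
    injective. *)
Lemma perm_fabP : perm_poly (fab q a b) <->
  (forall x, x ^+ q.+1 = 1 -> dn x != 0) /\
  (forall x X, x ^+ q.+1 = 1 -> X ^+ q.+1 = 1 -> bz X x = 0 -> X = x).
Proof.
have q5 := q_ge5; split=> [/bij_inj finj|[hd hbz]].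
  have hd x : x ^+ q.+1 = 1 -> dn x != 0.
    move=> /unit_circle_norm1 [y y0 ->]; apply/eqP => d0; have [fy _] := fab_horner y0.
    by move/eqP: y0; apply; apply: finj; rewrite fab_horner0 fy d0 mulr0.
  split=> // x X hx hX hb0; have dx := hd x hx; have dX := hd X hX.
  have [y y0 xy] := unit_circle_norm1 hx; have [w w0 Xw] := unit_circle_norm1 hX.
  have quot : nm X / dn X = nm x / dn x.
    by apply/eqP; rewrite eqr_div // -subr_eq0 bezP hb0 mulr0.
  rewrite Xw in dX; rewrite xy in dx.
  have [u0 uq] := fab_quotient y0 dx; have [v0 vq] := fab_quotient w0 dX.
  rewrite -xy in uq; rewrite -Xw in vq.
  set u := horner _ y in u0 uq; set v := horner _ w in v0 vq.
  (* Equal images in mu make [c] an element of F_q, so f(c w) = c f(w) = f(y) and y = c w. *)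
  pose c := u / v; have c0 : c != 0 by rewrite mulf_neq0 ?invr_neq0.
  have cq : c ^+ q = c.
    have k0 : nm x / dn x != 0.
      by apply: contraNneq (expf_neq0 q u0) => k0; rewrite uq k0 mulr0.
    by rewrite /c exprMn exprVn uq vq quot -mulf_div divff // mulr1.
  have c1 : c ^+ (q - 1) = 1.
    by apply: (mulfI c0); rewrite -exprS subn1 prednK ?mulr1 //; lia.
  have cw : c * w = y.
    apply: finj; rewrite -/u; have [-> _] := fab_horner (mulf_neq0 c0 w0).
    rewrite exprMn c1 mul1r; have [fw _] := fab_horner w0.
    rewrite -!mulrA [w * _]mulrA -fw -/v.
    by rewrite mulVf // mulr1.
  by rewrite xy Xw -cw exprMn c1 mul1r.
apply: injF_bij => y w /= fyw.
have [y0|y0] := eqVneq y 0.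
  move: fyw; rewrite y0 fab_horner0; have [-> //|w0] := eqVneq w 0.
  have [fw hx] := fab_horner w0; have [u0 _] := fab_quotient w0 (hd _ hx).
  by move/esym/eqP; rewrite (negbTE u0).
have [w0|w0] := eqVneq w 0.
  move: fyw; rewrite w0 fab_horner0.
  have [fw hx] := fab_horner y0; have [u0 _] := fab_quotient y0 (hd _ hx).
  by move/eqP; rewrite (negbTE u0).
have [fy hx] := fab_horner y0; have [fw hX] := fab_horner w0.
have [u0 uq] := fab_quotient y0 (hd _ hx); have [_ vq] := fab_quotient w0 (hd _ hX).
move: (uq); rewrite fyw vq -fyw => /(mulfI u0)/eqP.
rewrite eqr_div ?hd // -subr_eq0 bezP mulf_eq0 => xX.
have {}xX : w ^+ (q - 1) = y ^+ (q - 1).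
  by case/orP: xX => [|/eqP /hbz]; [rewrite subr_eq0 => /eqP | apply].
move: fyw; rewrite fy fw xX -!mulrA.
by apply: mulIf; rewrite mulf_neq0 ?hd // invr_neq0 // (proj1 (unit_circle_frob hx)).
Qed.

(** The quadratic formula: as r^q = -r, the norm of [X] is (B^2 - disc) / (4 A C) = 1, with A, B, C
    the coefficients of [bez]. *)
Lemma bez_root x r : x ^+ q.+1 = 1 -> bzA x != 0 -> r ^+ q = - r ->
  dsc x = (r * x) ^+ 2 ->
  let X := (r * x - bzB x) / (2%:R * bzA x) in X ^+ q.+1 = 1 /\ bz X x = 0.
Proof.
move=> hx A0 rq hr X; have n2 := two_neq0; have n4 := four_neq0.
have [x0 xq] := unit_circle_frob hx.
have C0 : bzC x != 0.
  apply: contraNneq (expf_neq0 q A0) => C0.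
  by rewrite frob_bezA // C0 mul0r.
move: (frob_bezA hx) (frob_bezB hx) hr A0 C0; rewrite /X /bez /disc.
move: (bzA x) (bzB x) (bzC x) => A B C hA hB hr A0 C0.
have hC : C = (B ^+ 2 - (r * x) ^+ 2) / (4%:R * A).
  by rewrite -hr; field; rewrite n4 A0.
split; last by rewrite hC; field; rewrite ?n4 ?n2 ?A0 ?C0 ?x0 ?oner_neq0.
rewrite exprS !exprMn exprVn frobD frobN !exprMn frob_nat hA hB rq xq.
have -> : (r * x - B) / (2%:R * A) * ((- r / x - B / x ^+ 2) / (2%:R * (C / x ^+ 2)))
   = (B ^+ 2 - (r * x) ^+ 2) / (4%:R * A * C) by field; rewrite ?n4 ?n2 ?A0 ?C0 ?x0 ?oner_neq0.
by rewrite -hr; field; rewrite ?n4 ?n2 ?A0 ?C0 ?x0 ?oner_neq0.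
Qed.

(** * Consequences of injectivity on the unit circle *)

Lemma unit_circleN (x : F) : x ^+ q.+1 = 1 -> (- x) ^+ q.+1 = 1.
Proof. by move=> hx; rewrite exprS frobN mulrNN -exprS. Qed.

Lemma oppr_neq (x : F) : x != 0 -> - x != x.
Proof.
by move=> x0; rewrite eq_sym -subr_eq0 opprK -mulr2n -mulr_natl mulf_neq0 ?two_neq0.
Qed.

Definition unit_circle_injective :=
  forall x X, x ^+ q.+1 = 1 -> X ^+ q.+1 = 1 -> bz X x = 0 -> X = x.

(** A square root r of disc x / x^2 satisfies r^q = r or r^q = -r. In the second case both roots of
    [bez] in X lie in mu, so they equal [x] and r = 0. *)
Lemma disc_square x : unit_circle_injective -> x ^+ q.+1 = 1 ->
  (exists r, [/\ r != 0, r ^+ q = r & dsc x = (r * x) ^+ 2]) \/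
  [/\ dsc x = 0, bz x x = 0 & 2%:R * bzA x * x + bzB x = 0].
Proof.
move=> inj hx; have [x0 xq] := unit_circle_frob hx; have n2 := two_neq0; have n4 := four_neq0.
have [A0|A0] := eqVneq (bzA x) 0.
  have C0 : bzC x = 0.
    have : bzA x ^+ q * x ^+ 2 = bzC x by rewrite frob_bezA // divfK // expf_neq0.
    by rewrite A0 expr0n gtn_eqF ?mul0r //; have := q_ge5; lia.
  have B0 : bzB x != 0.
    (* If all three coefficients vanished, every point of mu would be a root; [- x] is one distinct
       from [x]. *)
    apply/eqP => B0; have /eqP := oppr_neq x0; apply.
    by apply: inj => //; [exact: unit_circleN | rewrite /bez A0 B0 C0; ring].
  left; exists (bzB x / x); split; first by rewrite mulf_neq0 ?invr_neq0.
    by rewrite exprMn exprVn frob_bezB // xq; field; rewrite ?n4 ?n2 ?A0 ?C0 ?x0 ?oner_neq0.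
  by rewrite /disc A0; field.
have [r hr] := subfield_sqrt (frob_disc hx).
have hd : dsc x = (r * x) ^+ 2 by rewrite exprMn hr divfK // expf_neq0.
have : (r ^+ q - r) * (r ^+ q + r) = 0.
  rewrite -subr_sqr exprAC hr frob_disc //; exact: subrr.
move/eqP; rewrite mulf_eq0 subr_eq0 addr_eq0.
have [r0|r0] := eqVneq r 0; last first.
  case/orP => /eqP rq; first by left; exists r.
  have [h1 h2] := bez_root hx A0 rq hd.
  have rq' : (- r) ^+ q = - - r by rewrite frobN rq.
  have hd' : dsc x = (- r * x) ^+ 2 by rewrite hd; ring.
  have [h3 h4] := bez_root hx A0 rq' hd'.
  have /eqP := etrans (inj _ _ hx h1 h2) (esym (inj _ _ hx h3 h4)).
  rewrite eqr_div ?mulf_neq0 // => /eqP /(mulIf (mulf_neq0 n2 A0)) /addIr /eqP.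
  by rewrite mulNr eq_sym (negbTE (oppr_neq _)) // mulf_neq0.
move=> _; right; have rq : r ^+ q = - r.
  by rewrite r0 expr0n gtn_eqF ?oppr0 //; have := q_ge5; lia.
have [h1 h2] := bez_root hx A0 rq hd; have xE := inj _ _ hx h1 h2.
split; first by rewrite hd r0; ring.
  by rewrite -[in X in bz X _]xE.
by rewrite -{2}xE r0; field; rewrite ?n4 ?n2 ?A0 ?C0 ?x0 ?oner_neq0.
Qed.

(** On the diagonal [bez] is a polynomial of degree 4 with leading coefficient [- b], too small to
    vanish at all q + 1 points of mu. At such a point the degenerate alternative of [disc_square] is
    excluded. *)
Lemma exists_bez_diag_neq0 : exists2 x, x ^+ q.+1 = 1 & bz x x != 0.
Proof.
case: (boolP [exists x : F, (x ^+ q.+1 == 1) && (bz x x != 0)]).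
  by case/existsP => x /andP[/eqP]; exists x.
rewrite negb_exists => /forallP bz0.
pose G := quartic (- b') (2%:R * a) (3%:R * bzE + 1) (2%:R * a') (- b).
have G0 : G != 0.
  apply: contra_neq hb => G0; have := coef0 F 4; rewrite -G0 coef_quartic /=.
  by move/eqP; rewrite oppr_eq0 => /eqP.
have /(dvdp_leq G0) : 'X^(q.+1) - 1 %| G.
  apply: unit_circle_dvdp => x hx; have := bz0 x; rewrite hx eqxx /= negbK => /eqP bzx.
  apply/rootP; rewrite -bzx horner_quartic /bez /bezA /bezB /bezC; ring.
rewrite size_XnsubC // => /leq_trans/(_ (size_quartic _ _ _ _ _)).
by have := q_ge5; lia.
Qed.

Lemma disc_relations : unit_circle_injective ->
  disc3 a a' b b' ^+ 2 * disc0 a a' b b' = disc1 a a' b b' ^+ 2 * disc4 a a' b b'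
  /\ 8%:R * disc4 a a' b b' ^+ 2 * disc1 a a' b b'
    = disc3 a a' b b' * (4%:R * disc4 a a' b b' * disc2 a a' b b' - disc3 a a' b b' ^+ 2).
Proof.
move=> inj; have q5 := q_ge5.
apply: self_reciprocal_quartic_square.
- by rewrite /disc0 /disc4 /bezE /a' /b' !frobE; ring.
- by rewrite /disc1 /disc3 /bezE /a' /b' !frobE; ring.
- by rewrite /disc2 /bezE /a' /b' !frobE; ring.
move=> x hx; have [x0 xq] := unit_circle_frob hx.
have -> : (quartic (disc0 a a' b b') (disc1 a a' b b') (disc2 a a' b b')
    (disc3 a a' b b') (disc4 a a' b b')).[x] = dsc x.
  by rewrite discE horner_quartic.
case: (disc_square inj hx) => [[r [r0 rq ->]]|[-> bx hAB]].
  (* Here x^2 (r x)^(q-1) = r^(q-1) x^(q+1) = 1. *)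
  left; rewrite -exprM; have -> : (2 * q./2)%N = (q - 1)%N.
    by have := odd_double_half q; rewrite q_odd; lia.
  have r1 : r ^+ (q - 1) = 1.
    by apply: (mulfI r0); rewrite -exprS subn1 prednK ?mulr1 //; lia.
  by rewrite exprMn r1 mul1r -exprD -hx; congr (_ ^+ _); lia.
right; split=> //; rewrite deriv_quartic horner_quartic mul0r addr0 disc_deriv.
by rewrite hAB bx; ring.
Qed.

(** The condition on [L] says that L x / x lies in F_q, so dividing the nonzero square disc x / x^2
    by its square exhibits [s] as a square in F_q. *)
Lemma nz_square_disc s (L : F -> F) : (forall x, dsc x = s * L x ^+ 2) ->
  (forall x, x ^+ q.+1 = 1 -> L x ^+ q = L x / x ^+ 2) ->
  unit_circle_injective -> nz_square_q q s.
Proof.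
move=> hs hL inj; have [x hx bx] := exists_bez_diag_neq0.
have [x0 xq] := unit_circle_frob hx.
case: (disc_square inj hx) => [[r [r0 rq hr]]|[_ bx0 _]]; last by rewrite bx0 eqxx in bx.
have L0 : L x != 0.
  apply: contraNneq (expf_neq0 2 (mulf_neq0 r0 x0)) => L0.
  by rewrite -hr hs L0 expr0n mulr0.
have sE : s = (r * x / L x) ^+ 2.
  by rewrite exprMn -hr hs exprVn mulfK // expf_neq0.
have yq : (r * x / L x) ^+ q = r * x / L x.
  by rewrite !exprMn exprVn rq xq hL //; field; rewrite L0 x0 ?oner_neq0.
split; last by exists (r * x / L x).
  by rewrite sE expf_neq0 // !mulf_neq0 // invr_neq0.
by rewrite sE exprAC yq.
Qed.

(** For a root X in mu, r = (2 A X + B) / x has r^q = -r, but r^2 = disc x / x^2 is the square of an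
    element of F_q; hence r = 0. *)
Lemma bez_eq0_lin s (L : F -> F) : (forall x, dsc x = s * L x ^+ 2) ->
  (forall x, x ^+ q.+1 = 1 -> L x ^+ q = L x / x ^+ 2) -> nz_square_q q s ->
  forall x X, x ^+ q.+1 = 1 -> X ^+ q.+1 = 1 -> bz X x = 0 -> L x = 0.
Proof.
move=> hs hL [s0 _ [y [yq hy]]] x X hx hX hb0.
have [x0 xq] := unit_circle_frob hx; have [X0 Xq] := unit_circle_frob hX.
pose r := (2%:R * bzA x * X + bzB x) / x.
have rq : r ^+ q = - r.
  have hC : bzC x = - (bzA x * X ^+ 2 + bzB x * X).
    by apply/eqP; rewrite -addr_eq0 addrC -hb0.
  rewrite /r !exprMn exprVn xq; move: (frob_bezA hx) (frob_bezB hx) hC.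
  move: (bzA x) (bzB x) (bzC x) => A B C hA hB hC.
  by rewrite frobD !exprMn frob_nat hA hB Xq hC; field; rewrite X0 x0 ?oner_neq0.
pose m := y * L x / x.
have mq : m ^+ q = m by rewrite /m !exprMn exprVn yq hL // xq; field; rewrite x0 ?oner_neq0.
have rm : r ^+ 2 = m ^+ 2.
  by rewrite /r /m !exprMn bez_sqr hb0 mulr0 addr0 hs -hy.
have r0 : r = 0.
  apply/eqP; apply: contraT => r0; have := oppr_neq r0.
  move/eqP: rm; rewrite eqf_sqr -rq => /orP[] /eqP ->; rewrite ?frobN mq eqxx //.
apply/eqP; move/esym/eqP: rm; rewrite r0 expr0n /= expf_eq0 /= !mulf_eq0 invr_eq0.
rewrite (negbTE x0) orbF => /orP[/eqP y0|//].
by move: s0; rewrite -hy y0 expr0n eqxx.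
Qed.

(** Otherwise t / p is a root of [den], and it lies in mu because t is in F_q and t^2 = p p^q. *)
Lemma bezdet_eq0_case1 : (forall x, x ^+ q.+1 = 1 -> dn x != 0) ->
  bezdet a a' b b' = 0 -> a * b + a' * bzE = 0.
Proof.
move=> hd det0; apply/eqP; apply: contraT => p0.
have [] := bezdet_eq0_root det0 p0.
set p1 := a * b + a' * bzE in p0 *; set t := b * b' - bzE ^+ 2 => ht hr.
have pq : p1 ^+ q = a' * b' + a * bzE.
  by rewrite /p1 /bezE /a' /b' !frobE; ring.
have tq : t ^+ q = t by rewrite /t /bezE /a' /b' expr2 !frobE; ring.
have hx : (t / p1) ^+ q.+1 = 1.
  have pq0 : p1 ^+ q != 0 by exact: expf_neq0.
  rewrite exprS exprMn exprVn tq mulf_div -expr2 ht -pq divff //.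
  exact: mulf_neq0.
by have := hd _ hx; rewrite hr eqxx.
Qed.

(** The discriminant of [bezB] is ((E + 1) y)^2 with y in F_q, so z = 2 a' x + E + 1 lies in F_q at
    a root [x]. Yet z + z^q = 2 bezB x / x = 0, which forces z = 0 and y = 0. *)
Lemma bezB_case1_neq0 :
  a * b + a' * bzE = 0 -> a' * b' + a * bzE = 0 ->
  nz_square_q q (1 - 4%:R * (b * b' / (a * a'))) ->
  forall x, x ^+ q.+1 = 1 -> bzB x != 0.
Proof.
move=> hI hI' [s0 _ [y [yq hy]]] x hx; apply/eqP => B0.
have [x0 xq] := unit_circle_frob hx; have a'0 := a'_neq0.
have [e2 hn] := bezE_case1 ha a'0 hI hI'.
have e10 : bzE + 1 != 0.
  apply: contraNneq (mulf_neq0 ha a'0) => e10.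
  by rewrite hn expr2 -{1}[bzE]mulr1 -mulrDr addrC e10 mulr0.
pose z := 2%:R * a' * x + (bzE + 1).
have eq2 : bzE ^+ 2 / (a * a') = bzE / (bzE + 1).
  have en0 : bzE + bzE ^+ 2 != 0 by rewrite -hn mulf_neq0.
  by rewrite hn; field; rewrite e10 en0.
have hz : z ^+ 2 = ((bzE + 1) * y) ^+ 2.
  rewrite exprMn hy e2 eq2.
  have -> : z ^+ 2 = 4%:R * a' * bzB x + (bzE + 1) ^+ 2 - 4%:R * (a * a').
    by rewrite /z /bezB; ring.
  by rewrite B0 hn; field.
have mq : ((bzE + 1) * y) ^+ q = (bzE + 1) * y.
  by rewrite exprMn frobD frob_bezE expr1n yq.
have zq : z ^+ q = z.
  by move/eqP: hz; rewrite eqf_sqr => /orP[] /eqP ->; rewrite ?frobN mq.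
have y0 : y != 0 by apply: contra_neq s0 => y0; rewrite -hy y0 expr0n.
have zE : 2%:R * z = 0.
  have -> : 2%:R * z = z + z ^+ q by rewrite zq; ring.
  have -> : z ^+ q = 2%:R * a / x + (bzE + 1).
    by rewrite frobD frobD frob_bezE expr1n !exprMn frob_nat xq /a' frobK.
  rewrite -[RHS](mul0r (2%:R / x)) -B0 /z /bezB; field.
  by rewrite x0 ?oner_neq0.
move/eqP: zE; rewrite mulf_eq0 (negbTE two_neq0) /= => /eqP z0.
move/esym/eqP: hz; rewrite z0 expr0n expf_eq0 /= mulf_eq0.
by rewrite (negbTE e10) (negbTE y0).
Qed.

(** * The two implications *)

Lemma frob_linII x : x ^+ q.+1 = 1 -> linII a a' x ^+ q = linII a a' x / x ^+ 2.
Proof.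
move=> hx; have [x0 xq] := unit_circle_frob hx; have n3 := three_neq0.
rewrite /linII !frobE ?exprAC !xq /a' ?frobE -/a'.
by field; rewrite ?x0 ?n3 ?oner_neq0.
Qed.

Lemma case1_conj : a * b + a' * bzE = 0 <-> a' * b' + a * bzE = 0.
Proof.
have h1 : (a * b + a' * bzE) ^+ q = a' * b' + a * bzE.
  by rewrite /bezE /a' /b' !frobE; ring.
split=> [h0|h0]; first by rewrite -h1 h0 expr0n gtn_eqF //; have := q_ge5; lia.
by move/eqP: h1; rewrite h0 expf_eq0 => /andP[_ /eqP].
Qed.

Lemma case2_conj : a' + 3%:R * a * b = 0 -> a + 3%:R * a' * b' = 0.
Proof.
move=> h0; have -> : a + 3%:R * a' * b' = (a' + 3%:R * a * b) ^+ q.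
  by rewrite /a' /b' frobD !exprMn frobK frob_nat.
by rewrite h0 expr0n gtn_eqF //; have := q_ge5; lia.
Qed.

Lemma num_eq0 x : x ^+ q.+1 = 1 -> dn x = 0 -> nm x = 0.
Proof.
move=> hx d0; have [x0 _] := unit_circle_frob hx.
have : dn x ^+ q * x ^+ 3 = nm x by rewrite frob_den // divfK // expf_neq0.
by rewrite d0 expr0n gtn_eqF ?mul0r //; have := q_ge5; lia.
Qed.

Lemma perm_fab_case : perm_poly (fab q a b) ->
  (a * b + a' * bzE = 0 /\ nz_square_q q (1 - 4%:R * (b * b' / (a * a')))) \/
  (a' + 3%:R * a * b = 0 /\
     nz_square_q q (- 3%:R * (1 - 4%:R * (b * b' / (a * a'))))).
Proof.
move=> /perm_fabP[hd inj]; have [rel1 rel2] := disc_relations inj.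
have a'0 := a'_neq0; have n3 := three_neq0.
have [det0|det0] := eqVneq (bezdet a a' b b') 0.
  left; have hI := bezdet_eq0_case1 hd det0; split=> //.
  apply: (nz_square_disc _ frob_bezB inj).
  by apply: disc_case1 => //; apply/case1_conj.
right; have hII := bezdet_neq0_case two_neq0 ha a'0 det0 rel1 rel2; split=> //.
apply: (nz_square_disc _ frob_linII inj).
by apply: disc_case2 => //; apply: case2_conj.
Qed.

Lemma case1_perm_fab : a * b + a' * bzE = 0 ->
  nz_square_q q (1 - 4%:R * (b * b' / (a * a'))) -> perm_poly (fab q a b).
Proof.
move=> hI hs; have hI' := (case1_conj.1 hI).
have B0 := bezB_case1_neq0 hI hI' hs; apply/perm_fabP; split=> [x hx|x X hx hX hb0].
  apply: contra_neq (B0 x hx) => d0.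
  by rewrite bezB_num_den bezA_num_den num_eq0 // d0; ring.
have := B0 x hx; rewrite (bez_eq0_lin (disc_case1 ha a'_neq0 hI hI') frob_bezB hs hx hX hb0).
by rewrite eqxx.
Qed.

(** By symmetry of [bez], a zero with X != x makes both points roots of [linII], so [bez_case2]
    gives 9 a a' = 4. This is excluded, since b b' = 1/9 turns the constant in (II) into a multiple
    of 9 a a' - 4. *)
Lemma case2_perm_fab : a' + 3%:R * a * b = 0 ->
  nz_square_q q (- 3%:R * (1 - 4%:R * (b * b' / (a * a')))) -> perm_poly (fab q a b).
Proof.
move=> hII hs; have hII' := case2_conj hII; have a'0 := a'_neq0; have n3 := three_neq0.
have dsc2 := disc_case2 n3 ha a'0 hII hII'.
have [bE b'E] := case2_b n3 ha a'0 hII hII'.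
have n9 : 9%:R != 0 :> F by rewrite (natrM _ 3 3) mulf_neq0.
have s0 : - 3%:R * (1 - 4%:R * (b * b' / (a * a'))) != 0 by case: hs.
have n0 : 9%:R * a * a' - 4%:R != 0.
  apply: contra_neq s0 => n0.
  transitivity (- 3%:R * ((9%:R * a * a' - 4%:R) / (9%:R * a * a'))); last first.
    by rewrite n0 mul0r mulr0.
  by rewrite bE b'E; field; rewrite ?n9 ?n3 ?ha ?a'0.
have lin0 := bez_eq0_lin dsc2 frob_linII hs.
apply/perm_fabP; split=> [x hx|x X hx hX hb0].
  apply/eqP => d0; have [x0 _] := unit_circle_frob hx.
  have A0 : bzA x = 0 by rewrite bezA_num_den num_eq0 // d0; ring.
  have B0 : bzB x = 0 by rewrite bezB_num_den A0 d0; ring.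
  have L0 : linII a a' x = 0.
    move/eqP: (dsc2 x); rewrite /disc A0 B0 expr0n /= mulr0 mul0r subrr eq_sym.
    by rewrite mulf_eq0 (negbTE s0) expf_eq0 => /eqP.
  move/eqP: n0; apply; apply: (mulfI x0).
  (* In 3 linII - bezB the terms of degrees 0 and 2 cancel. *)
  transitivity (9%:R / 2%:R * (3%:R * linII a a' x - bzB x)).
    by rewrite /linII /bezB /bezE bE b'E; field; rewrite ?two_neq0 ?n3 ?n9 ?ha ?a'0.
  by rewrite L0 B0; ring.
apply/eqP; apply: contraT => Xx.
have hb0' : bz x X = 0 by rewrite bez_sym.
have := bez_case2 n3 ha a'0 hII hII' Xx (lin0 _ _ hX hx hb0') (lin0 _ _ hx hX hb0).
move/esym/eqP; rewrite hb0 !mulf_eq0 invr_eq0 ?mulf_eq0.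
by rewrite (negbTE ha) (negbTE a'0) (negbTE n9) ?expf_eq0 (negbTE n0).
Qed.

End QuadraticExtension.

Unset Implicit Arguments. Set Strict Implicit.

Theorem mainTheorem1 (F : finFieldType) (p h : nat)
  (hp : prime p) (hp3 : (3 < p)%N) (hh : (1 <= h)%N)
  (hF : #|F| = ((p ^ h) ^ 2)%N) (a b : F) (ha : a != 0) (hb : b != 0) :
  let q := (p ^ h)%N in
  perm_poly (fab q a b) <->
  ((a ^+ q * b ^+ q = a * (b ^+ q.+1 - a ^+ q.+1)
      /\ nz_square_q q (1 - 4%:R * (b / a) ^+ q.+1))
   \/
   (a ^+ (q - 1) + 3%:R * b = 0
      /\ nz_square_q q (- 3%:R * (1 - 4%:R * (b / a) ^+ q.+1)))).
Proof.
move=> q; have q0 : (0 < q)%N by rewrite expn_gt0 prime_gt0.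
have -> : (b / a) ^+ q.+1 = b * b ^+ q / (a * a ^+ q).
  by rewrite exprMn exprVn !exprS.
(* Condition (I) literally reads a' b' + a E = 0, the conjugate of the equation used above. *)
have hI : a ^+ q * b ^+ q = a * (b ^+ q.+1 - a ^+ q.+1) <->
    a * b + a ^+ q * bezE a (a ^+ q) b (b ^+ q) = 0.
  apply: (iff_trans _ (iff_sym (case1_conj hp hp3 hh hF ha hb))).
  rewrite /bezE !exprS; split=> [->|/eqP]; first by ring.
  by rewrite addr_eq0 -mulrN opprB => /eqP.
have hII : a ^+ (q - 1) + 3%:R * b = 0 <-> a ^+ q + 3%:R * a * b = 0.
  have -> : a ^+ q + 3%:R * a * b = a * (a ^+ (q - 1) + 3%:R * b).
    by rewrite mulrDr -exprS subn1 prednK //; ring.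
  by split=> [->|/eqP]; rewrite ?mulr0 // mulf_eq0 (negbTE ha) => /eqP.
rewrite hI hII; split; first exact: perm_fab_case.
by case=> -[]; [exact: case1_perm_fab | exact: case2_perm_fab].
Qed.
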